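(* Let $T\in\mathfrak{E}_1(H)$, let $\mathcal{M}$ be the projective line of one-dimensional subspaces of $\mathcal{B}_T$ with its Fubini–Study metric, let $\omega$ be the corresponding normalized volume form, and let $\mathcal{C}\subset\mathcal{M}$ be the subset of strictly dissipative boundary conditions with non-vanishing mean type. Then $\mathcal{C}$ is Borel measurable and the $\omega$-measure of $\mathcal{C}$ is zero.
   Context: Entire operators. $H$ denotes a separable infinite-dimensional complex Hilbert space (inner products are linear in the first variable). A symmetric operator $T$ in $H$ is a linear operator on a subspace $D(T)\subset H$, not necessarily dense, with $(Tx,y)=(x,Ty)$ for all $x,y\in D(T)$; it is always assumed closed. $T$ is simple if it has no nontrivial self-adjoint part as an orthogonal direct summand. On $\mathbb{H}=H\oplus H$ put $[x,y]_c=(x_2,y_1)_H-(x_1,y_2)_H$ for $x=(x_1,x_2)$, $y=(y_1,y_2)$. Let $A_T\subset\mathbb{H}$ be the graph of $T$, $A_T^{\bot_s}=\{x\in\mathbb{H}: [x,y]_c=0\ \forall y\in A_T\}\supset A_T$, and $\mathcal{B}_T=A_T^{\bot_s}/A_T$ with the induced form $[\cdot,\cdot]_q$ and the quotient Hilbert space structure. The signature of $-\mathrm{i}[\cdot,\cdot]_q$ is the pair of deficiency indices of $T$, assumed to be $(1,1)$ (so $\dim\mathcal{B}_T=2$). $T$ is called regular (equivalently: entire) if for every $\lambda\in\mathbb{C}$ there is $c_\lambda>0$ with $\|(T-\lambda)x\|\ge c_\lambda\|x\|$ for all $x\in D(T)$. $\mathfrak{E}_1(H)$ is the set of closed simple symmetric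 entire operators in $H$ with deficiency indices $(1,1)$. The Fubini–Study metric on $\mathcal{M}$ is the one induced by the Hermitian inner product of $\mathcal{B}_T$; the volume form is normalized to have total mass $1$. Boundary triplets and boundary conditions. A boundary triplet $(\mathbb{C},\Gamma_+,\Gamma_-)$ for $T$ consists of linear maps $\Gamma_\pm:A_T^{\bot_s}\to\mathbb{C}$ vanishing on $A_T$, inducing an isomorphism $\mathcal{B}_T\to\mathbb{C}^2$, with $[x,y]_c=\mathrm{i}\,\Gamma_+x\,\overline{\Gamma_+y}-\mathrm{i}\,\Gamma_-x\,\overline{\Gamma_-y}$. Points $m\in\mathcal{M}$ (boundary conditions) correspond to generic extensions $T_m$, the subspaces between $A_T$ and $A_T^{\bot_s}$ with image $m$ in $\mathcal{B}_T$; given a triplet they are $T_c=\{a\in A_T^{\bot_s}:\Gamma_-a=c\,\Gamma_+a\}$, $c\in\mathbb{C}$, and $T_\infty=\{\Gamma_+a=0\}$. $T_c$ is strictly dissipative if $|c|<1$ (independent of the triplet), and every strictly dissipative extension equals $T_0$ for a suitable triplet. With $W_\lambda=\{(x,\lambda x):x\in H\}\cap A_T^{\bot_s}$ (one-dimensional), the contractive Weyl function $B$ is defined for $\Im\lambda>0$ by $\Gamma_-a=B(\lambda)\Gamma_+a$, $a\in W_\lambda$; it extends to a meromorphic inner function of the form $B(\lambda)=\gamma e^{\mathrm{i}b\lambda}\prod_k\frac{\overline{\lambda_k}}{\lambda_k}\frac{\lambda-\lambda_k}{\lambda-\overline{\lambda_k}}$ with $|\gamma|=1$, $b\ge0$,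 $\{\lambda_k\}$ its zeros in the upper half-plane. Mean type. If a strictly dissipative boundary condition $m$ is given and the triplet is chosen so that $T_m=T_0$, then the number $b$, equivalently $b=-\limsup_{y\to+\infty}\frac{\ln|B(\mathrm{i}y)|}{y}$, depends only on $m$ and is called the mean type of $m$. *)

(* Defs.v *)
(* MathComp-Analysis; the field of complex numbers is R[i] for R : realType. *)
From HB Require Import structures.
From mathcomp Require Import all_boot all_order all_algebra.
From mathcomp Require Import all_classical all_reals all_analysis.
From mathcomp Require Import complex.

Set Implicit Arguments.
Unset Strict Implicit.
Unset Printing Implicit Defensive.

Import Order.TTheory GRing.Theory Num.Theory numFieldNormedType.Exports.

Local Open Scope classical_set_scope.
Local Open Scope ring_scope.
Local Open Scope complex_scope.

Definition separable (X : topologicalType) : Prop :=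
  exists2 D : set X, countable D & dense D.

Section Linear.
Context {K : nzRingType}.

Definition subspace {V : lmodType K} (S : set V) : Prop :=
  S 0 /\ forall (a : K) (x y : V), S x -> S y -> S (a *: x + y).

Definition linear_on {V W : lmodType K} (S : set V) (f : V -> W) : Prop :=
  forall (a : K) (x y : V), S x -> S y -> f (a *: x + y) = a *: f x + f y.

Definition infinite_dimensional (V : lmodType K) : Prop :=
  forall (n : nat) (e : 'I_n -> V),
    exists x : V, forall c : 'I_n -> K, x <> \sum_i c i *: e i.

(* The values of [app] outside [dom] are irrelevant. *)
Record operator (V : lmodType K) := Operator {
  dom : set V;
  app :> V -> V;
  dom_subspace : subspace dom;
  app_linear : linear_on dom app
}.

Definition graph {V : lmodType K} (T : operator V) : set (V * V) :=
  [set x | dom T x.1 /\ x.2 = T x.1].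

End Linear.

(* The Hermitian form on V / W induced by f has p positive and n negative
   squares: in some basis of V / W (given by representatives in V) it is
   diagonal, with p positive and n negative diagonal entries.  In R[i], 0 < z
   means that z is real and positive. *)
Definition signature {K : numDomainType} {V : lmodType K} (S W : set V)
    (f : V -> V -> K) (p n : nat) : Prop :=
  exists e : 'I_(p + n) -> V,
    [/\ forall i, S (e i),
        forall x, S x -> exists c : 'I_(p + n) -> K, W (x - \sum_i c i *: e i),
        forall c : 'I_(p + n) -> K, W (\sum_i c i *: e i) -> forall i, c i = 0,
        forall i j, i != j -> f (e i) (e j) = 0
      & forall i : 'I_(p + n), if (i < p)%N then 0 < f (e i) (e i) else f (e i) (e i) < 0].

Section Hilbert.
Context {R : realType} {H : completeNormedModType R[i]}.
Variable ip : {dot H for Num.conj}.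

Definition hilbert_norm : Prop := forall x : H, ip x x = `|x| ^+ 2.

Definition orthocomplement (K : set H) : set H :=
  [set x | forall y, K y -> ip x y = 0].

(* Inner product and norm of the Hilbert space H (+) H (the norm that the
   library puts on H * H is the equivalent max norm). *)
Definition ip2 (x y : H * H) : R[i] := ip x.1 y.1 + ip x.2 y.2.

Definition sform (x y : H * H) : R[i] := ip x.2 y.1 - ip x.1 y.2.

Definition symplectic_complement (A : set (H * H)) : set (H * H) :=
  [set x | forall y, A y -> sform x y = 0].

Definition adj (T : operator H) : set (H * H) :=
  symplectic_complement (graph T).

Definition symmetric_op (T : operator H) : Prop :=
  forall x y, dom T x -> dom T y -> ip (T x) y = ip x (T y).

Definition closed_op (T : operator H) : Prop := closed (graph T).

(* T is the orthogonal sum of operators in K and in its complement. *)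
Definition reduces (T : operator H) (K : set H) : Prop :=
  forall x, dom T x -> exists x1 x2 : H,
    [/\ x = x1 + x2, dom T x1 /\ K x1, dom T x2 /\ orthocomplement K x2,
        K (T x1) & orthocomplement K (T x2)].

(* The restriction of T to dom T `&` K is a densely defined operator in the
   Hilbert space K and coincides with its adjoint there. *)
Definition selfadjoint_in (T : operator H) (K : set H) : Prop :=
  K `<=` closure (dom T `&` K) /\
  forall x y, K x -> K y ->
    (forall u, dom T u -> K u -> ip (T u) x = ip u y) <->
    (dom T x /\ y = T x).

Definition simple_op (T : operator H) : Prop :=
  forall K : set H, subspace K -> closed K ->
    reduces T K -> selfadjoint_in T K -> K = [set 0].

Definition deficiency_indices (T : operator H) (p n : nat) : Prop :=
  signature (adj T) (graph T) (fun x y => - 'i * sform x y) p n.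

Definition regular_op (T : operator H) : Prop :=
  forall l : R[i], exists2 c : R[i], 0 < c &
    forall x, dom T x -> c * `|x| <= `|T x - l *: x|.

Definition entire_operator11 (T : operator H) : Prop :=
  [/\ symmetric_op T, closed_op T, simple_op T, deficiency_indices T 1 1
    & regular_op T].

Section BoundaryConditions.
Variable T : operator H.

(* The subspace of the quotient B_T = adj T / graph T spanned by the class of
   v, seen as its preimage in adj T. *)
Definition line (v : H * H) : set (H * H) :=
  [set x | exists c a, graph T a /\ x = c *: v + a].

(* The projective line of one-dimensional subspaces of B_T; a subspace is
   represented by its preimage, i.e. by the corresponding generic extension. *)
Definition boundary_conditions : set (set (H * H)) :=
  [set line v | v in adj T `\` graph T].

Record boundary_triplet (Gp Gm : H * H -> R[i]) : Prop := BoundaryTriplet {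
  triplet_linear_plus : linear_on (adj T) (Gp : H * H -> R[i]^o);
  triplet_linear_minus : linear_on (adj T) (Gm : H * H -> R[i]^o);
  triplet_vanish : forall x, graph T x -> Gp x = 0 /\ Gm x = 0;
  triplet_injective : forall x, adj T x -> Gp x = 0 -> Gm x = 0 -> graph T x;
  triplet_surjective : forall s t : R[i],
    exists2 x, adj T x & Gp x = s /\ Gm x = t;
  triplet_green : forall x y, adj T x -> adj T y ->
    sform x y = 'i * Gp x * (Gp y)^* - 'i * Gm x * (Gm y)^*
}.

Definition extension (Gp Gm : H * H -> R[i]) (c : R[i]) : set (H * H) :=
  [set a | adj T a /\ Gm a = c * Gp a].

Definition strictly_dissipative (m : set (H * H)) : Prop :=
  exists (Gp Gm : H * H -> R[i]) (c : R[i]),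
    [/\ boundary_triplet Gp Gm, `|c| < 1 & m = extension Gp Gm c].

Definition defect (l : R[i]) : set (H * H) :=
  [set a | adj T a /\ a.2 = l *: a.1].

(* B is the contractive Weyl function of the triplet on the upper half-plane;
   its values elsewhere are irrelevant. *)
Definition weyl_function (Gp Gm : H * H -> R[i]) (B : R[i] -> R[i]) : Prop :=
  forall l : R[i], 0 < complex.Im l ->
    forall a, defect l a -> Gm a = B l * Gp a.

End BoundaryConditions.
End Hilbert.

Section MeanType.
Context {R : realType}.

Definition cexp (z : R[i]) : R[i] :=
  (expR (complex.Re z))%:C *
  (cos (complex.Im z) +i* sin (complex.Im z)).

(* Indices k with zk = None contribute the factor 1, so that finite and empty
   families of zeros are covered. *)
Definition blaschke_factor (zk : option R[i]) (l : R[i]) : R[i] :=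
  if zk is Some w then w^* / w * ((l - w) / (l - w^*)) else 1.

(* B (l) = g * exp (i b l) * prod_k blaschke_factor (z k) l for Im l > 0, where
   z enumerates the zeros of B in the upper half-plane, with multiplicities. *)
Definition inner_factorization (B : R[i] -> R[i]) (b : R) : Prop :=
  exists (g : R[i]) (z : nat -> option R[i]),
    [/\ `|g| = 1, 0 <= b,
        forall (k : nat) (w : R[i]), z k = Some w -> 0 < complex.Im w,
        forall l : R[i], 0 < complex.Im l ->
          (B l = 0 <-> exists k, z k = Some l)
      & forall l : R[i], 0 < complex.Im l ->
          (fun n : nat => g * cexp ('i * b%:C * l) *
             \prod_(k < n) blaschke_factor (z k) l : R[i]^o) @ \oo
          --> (B l : R[i]^o)].

Definition mean_type {H : completeNormedModType R[i]}
    (ip : {dot H for Num.conj}) (T : operator H) (m : set (H * H)) (b : R)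
    : Prop :=
  exists (Gp Gm : H * H -> R[i]) (B : R[i] -> R[i]),
    [/\ boundary_triplet ip T Gp Gm, m = extension ip T Gp Gm 0,
        weyl_function ip T Gp Gm B & inner_factorization B b].

Definition nonvanishing_mean_type {H : completeNormedModType R[i]}
    (ip : {dot H for Num.conj}) (T : operator H) : set (set (H * H)) :=
  [set m | [/\ boundary_conditions ip T m, strictly_dissipative ip T m
             & exists2 b : R, mean_type ip T m b & b != 0]].

End MeanType.

Section FubiniStudy.
Context {R : realType} {H : completeNormedModType R[i]}.
Variables (ip : {dot H for Num.conj}) (T : operator H).

(* As a Hilbert space, the quotient B_T = adj T / graph T is the orthogonal
   complement of the closed subspace graph T in adj T: each class is
   represented by its element of minimal norm in H (+) H. *)
Definition quotient_space : set (H * H) :=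
  [set x | adj ip T x /\ forall y, graph T y -> ip2 ip x y = 0].

Definition unit_vector (m : set (H * H)) : H * H :=
  xget 0 [set u | [/\ m u, quotient_space u & ip2 ip u u = 1]].

(* The geodesic distance of the Fubini-Study metric; it does not depend on the
   choice of the unit vectors. *)
Definition fs_dist (m1 m2 : set (H * H)) : R :=
  acos (complex.Re `|ip2 ip (unit_vector m1) (unit_vector m2)|).

Definition fs_open (U : set (set (H * H))) : Prop :=
  U `<=` boundary_conditions ip T /\
  forall m, U m -> exists2 e : R, 0 < e &
    forall m', boundary_conditions ip T m' -> fs_dist m m' < e -> U m'.

Definition borel_measurable (S : set (set (H * H))) : Prop :=
  <<s boundary_conditions ip T, fs_open >> S.

Definition orthonormal_basis (e1 e2 : H * H) : Prop :=
  [/\ quotient_space e1 /\ quotient_space e2,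
      ip2 ip e1 e1 = 1, ip2 ip e2 e2 = 1, ip2 ip e1 e2 = 0
    & forall x, quotient_space x -> exists s t : R[i], x = s *: e1 + t *: e2].

(* The affine chart z |-> [e1 + z e2] attached to an orthonormal basis of B_T
   covers the projective line up to the point [e2].  In it the Fubini-Study
   metric is |dz|^2 / (1 + |z|^2)^2 and its volume form is
   dx dy / (1 + x^2 + y^2)^2, of total mass pi. *)
Definition fs_chart (e1 e2 : H * H) (z : R * R) : set (H * H) :=
  line T (e1 + (z.1 +i* z.2) *: e2).

Definition fs_volume (e1 e2 : H * H) (S : set (set (H * H))) : \bar R :=
  (\int[lebesgue_measure \x lebesgue_measure]_(z in fs_chart e1 e2 @^-1` S)
     (pi * (1 + z.1 ^+ 2 + z.2 ^+ 2) ^+ 2)^-1%:E)%E.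

End FubiniStudy.

(* Main.v *)
Require Import Defs.
From HB Require Import structures.
From mathcomp Require Import all_boot all_order all_algebra.
From mathcomp Require Import all_classical all_reals all_analysis.
From mathcomp Require Import complex ring lra.

Import Order.TTheory GRing.Theory Num.Theory numFieldNormedType.Exports.
Local Open Scope classical_set_scope.
Local Open Scope ring_scope.
Local Open Scope complex_scope.

(** The set of strictly dissipative boundary conditions with non-vanishing mean
type contains at most one point.

Let m be the kernel of Gm for a boundary triplet (Gp, Gm), and suppose that its
mean type b is positive.  In the factorization
B(l) = g exp(i b l) prod_k (Blaschke factor) all factors except the exponential
have modulus at most 1, so |B(iy)| <= exp(-b y) for y > 0
([inner_factorization_bound]).  A defect vector a of T at iy satisfies
Gm a = B(iy) Gp a with Gp a <> 0, hence the point of the projective line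
represented by the defect space at iy has coordinate B(iy) in the chart
Gm / Gp, and it tends to 0, that is to m, as y grows.  The defect spaces
do not depend on the triplet, so two boundary conditions with non-vanishing mean
type are limits of the same path and coincide
([nonvanishing_mean_type_sub]).

The argument needs nonzero defect vectors in the upper half-plane
([defect_nontrivial]).  The range of T minus the conjugate of l is closed because
T is closed and regular.  If it were the whole space, every element x of the
adjoint relation would be, modulo the graph of T, of the form (u, l^* u), so
that -i [x, x] = -2 Im l |u|^2 <= 0; a triplet provides an x with
-i [x, x] = 1.  A vector orthogonal to the range comes from the projection
theorem ([exists_orthogonal]).

A set with at most one point is Borel, since distinct points of the projective
line have positive Fubini-Study distance ([fs_dist_gt0], the equality case of
the Cauchy-Schwarz inequality), and it has volume zero, since an affine chart is
injective and points are null for the planar Lebesgue measure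
([fs_volume_set1]). *)

(** * Sequences in normed spaces over the complex numbers *)

Section Sequences.
Context {R : realType}.

Lemma conjE (x : R[i]) : Num.conj x = conjc x.
Proof. reflexivity. Qed.

(** In the order of R[i] a positive number is a positive real number, so that
the archimedean property of R applies. *)
Lemma harmonic_complex_lt (e : R[i]) : 0 < e ->
  \forall n \near \oo, n.+1%:R^-1 < e.
Proof.
move=> e0; have eE : e = (complex.Re e)%:C by rewrite RRe_real ?gtr0_real.
have e0' : 0 < complex.Re e by rewrite -ltcR -eE.
near=> n; rewrite eE -(rmorph_nat (@real_complex R)) -fmorphV ltcR.
near: n; exact: (near_infty_natSinv_lt (PosNum e0')).
Unshelve. all: by end_near. Qed.

Lemma cvg_of_harmonic {V : completeNormedModType R[i]} (x : nat -> V) (C : R[i]) :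
  0 < C -> (forall n m, `|x n - x m| <= C * (n.+1%:R^-1 + m.+1%:R^-1)) ->
  cvg (x @ \oo).
Proof.
move=> C0 hx; apply/cauchy_cvgP/cauchy_exP => e e0.
have C2 : 0 < C * 2 by rewrite mulr_gt0 ?ltr0n.
have [N _ hN] := harmonic_complex_lt _ (divr_gt0 e0 C2).
exists (x N), N => // n /= Nn; rewrite -ball_normE /=.
apply: le_lt_trans (hx _ _) _.
have := ltrD (hN _ (leqnn N)) (hN _ Nn).
rewrite -(ltr_pM2l C0) => /lt_le_trans; apply.
by rewrite le_eqVlt; apply/orP; left; apply/eqP; field; rewrite gt_eqF.
Qed.

(** A complex number has no sign in general, so t <= C * e is tested at
e = t / (2 C), after checking that C is positive. *)
Lemma eps_le0 (C t : R[i]) :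
  0 <= t -> (forall e, 0 < e -> t <= C * e) -> t = 0.
Proof.
move=> t0 h; apply/eqP/negPn/negP => tn0.
have {tn0}t0 : 0 < t by rewrite lt_neqAle eq_sym tn0.
have C0 : 0 < C by have := lt_le_trans t0 (h 1 ltr01); rewrite mulr1.
have C2 : 0 < C * 2 by rewrite mulr_gt0 ?ltr0n.
have := h _ (divr_gt0 t0 C2).
have -> : C * (t / (C * 2)) = t / 2 by field; rewrite gt_eqF.
by rewrite ler_pdivlMr ?ltr0n // mulrDr mulr1 gerDl lt_geF.
Qed.

End Sequences.

(** * The projection theorem *)

Section Projection.
Context {R : realType} {H : completeNormedModType R[i]}.
Variable ip : {dot H for Num.conj}.
Hypothesis ipN : hilbert_norm ip.

Lemma ipC x y : ip x y = Num.conj (ip y x).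
Proof. by rewrite hermC expr0 mul1r. Qed.

Lemma ipZr a x y : ip x (a *: y) = Num.conj a * ip x y.
Proof. by rewrite linearZr_LR. Qed.

Lemma ipZl a x y : ip (a *: x) y = a * ip x y.
Proof. by rewrite linearZl_LR. Qed.

Lemma ipBl x y z : ip (x - y) z = ip x z - ip y z.
Proof. by rewrite linearBl. Qed.

Lemma ipBr x y z : ip x (y - z) = ip x y - ip x z.
Proof. by rewrite linearBr. Qed.

Lemma ipDl x y z : ip (x + y) z = ip x z + ip y z.
Proof. by rewrite linearDl. Qed.

Lemma ipDr x y z : ip x (y + z) = ip x y + ip x z.
Proof. by rewrite linearDr. Qed.

Lemma ip0l x : ip 0 x = 0. Proof. by rewrite linear0l. Qed.

Lemma ip0r x : ip x 0 = 0. Proof. by rewrite linear0r. Qed.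

Lemma ip_ge0 x : 0 <= ip x x.
Proof. by rewrite ipN exprn_ge0. Qed.

(** The chosen t minimizes |w - t k|^2.  The minimal value gives the
Cauchy-Schwarz inequality and, when |w - t k| is bounded below by a distance,
a bound of the inner product of w and k by the excess of |w| over that
distance. *)
Lemma ip_sub_best w k : let t := ip w k / ip k k in
  ip (w - t *: k) (w - t *: k) * ip k k = ip w w * ip k k - `|ip w k| ^+ 2.
Proof.
have [->|k0] := eqVneq k 0; first by rewrite /= !ip0r normr0 !mulr0 expr0n subr0.
have kk : ip k k != 0 by rewrite ipN expf_eq0 /= normr_eq0.
have kkJ : Num.conj (ip k k) = ip k k by rewrite -ipC.
have tJ : Num.conj (ip w k / ip k k) = Num.conj (ip w k) / ip k k.
  rewrite rmorphM fmorphV; congr (_ * _^-1); exact: kkJ.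
rewrite /= ipBl !ipBr !ipZr !ipZl normCK (ipC k w) tJ.
by field.
Qed.

Lemma cauchy_schwarz x y : `|ip x y| <= `|x| * `|y|.
Proof.
rewrite -(@ler_pXn2r _ 2) ?nnegrE ?mulr_ge0 // exprMn -!ipN -subr_ge0.
by rewrite -ip_sub_best mulr_ge0 ?ip_ge0.
Qed.

(** Take a sequence r n in K with |v - r n|^2 < d + 1/(n+1)^2, where d is the
infimum of |v - x|^2 over x in K.  Moving r n inside K along k cannot go below d, so
the inner product of v - r n with k in K is at most |k| / (n+1).  Applied to
k = r n - r m this shows that the sequence is Cauchy, and in the limit it gives
orthogonality. *)
Lemma exists_orthogonal (K : set H) v : Defs.subspace K -> closed K ->
  exists2 r, K r & forall k, K k -> ip (v - r) k = 0.
Proof.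
move=> [K0 Ks] Kc.
pose f x := complex.Re (ip (v - x) (v - x)).
have fE x : (f x)%:C = ip (v - x) (v - x).
  by rewrite /f RRe_real // ger0_real ?ip_ge0.
have f0 x : 0 <= f x by rewrite -lecR fE ip_ge0.
have hE : has_inf (f @` K).
  by split; [exists (f 0), 0 | exists 0 => _ [x _ <-]].
pose d := inf (f @` K).
have df x : K x -> d <= f x.
  by move=> Kx; apply: ge_inf; [case: hE | exists x].
have /choice[r hr] : forall n, exists x,
    K x /\ f x < d + n.+1%:R^-1 ^+ 2.
  move=> n.
  have /inf_adherent/(_ hE)[_ [x Kx <-] hx] : 0 < (n.+1%:R^-1 ^+ 2 : R).
    by rewrite exprn_gt0 ?invr_gt0 ?ltr0n.
  by exists x.
have key n k : K k -> `|ip (v - r n) k| <= `|k| * n.+1%:R^-1.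
  move=> Kk; have [Kr hrn] := hr n.
  rewrite -(@ler_pXn2r _ 2) ?nnegrE ?mulr_ge0 ?invr_ge0 ?ler0n //.
  rewrite exprMn -ipN.
  have := ip_sub_best (v - r n) k; set t := _ / _ => /= E.
  have -> : `|ip (v - r n) k| ^+ 2 = ip k k *
     (ip (v - r n) (v - r n) - ip (v - r n - t *: k) (v - r n - t *: k)).
    by rewrite mulrBr ![ip k k * _]mulrC E; ring.
  apply: ler_wpM2l; first exact: ip_ge0.
  rewrite -[v - r n - _]addrA -opprD -!fE -rmorphB /=.
  rewrite -(rmorph_nat (@real_complex R)) -fmorphV -rmorphXn lecR.
  have h : d <= f (r n + t *: k) by apply: df; rewrite addrC; exact: Ks.
  by rewrite lerBlDr (le_trans (ltW hrn)) // addrC lerD2l.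
have KB x y : K x -> K y -> K (x - y).
  by move=> Kx Ky; rewrite addrC -scaleN1r; exact: Ks.
have rc : cvg (r @ \oo).
  apply: (@cvg_of_harmonic _ _ _ 1) => // p q; rewrite mul1r.
  have [->|] := eqVneq (r p - r q) 0.
    by rewrite normr0 addr_ge0 ?invr_ge0 ?ler0n.
  set k := r p - r q => k0.
  have Kk : K k by apply: KB; [case: (hr p)|case: (hr q)].
  have nk : 0 < `|k| by rewrite normr_gt0.
  rewrite -(ler_pM2l nk) -expr2 -ipN -[leLHS]ger0_norm ?ip_ge0 // {1}/k.
  have -> : r p - r q = (v - r q) - (v - r p).
    by rewrite opprB [RHS]addrC addrA subrK.
  rewrite ipBl (le_trans (ler_normB _ _)) // mulrDr addrC lerD ?key //.
exists (lim (r @ \oo)).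
  by apply: (closed_cvg _ Kc _ _ rc); near=> n; case: (hr n).
move=> k Kk; apply/normr0_eq0/(@eps_le0 _ (`|k| * 2)) => // e e0.
have [N _ hN] := harmonic_complex_lt _ e0.
have /cvgrPdist_lt/(_ e e0)[M _ hM] := rc.
pose n := maxn N M.
rewrite -(subrK (r n) v) -addrA ipDl (le_trans (ler_normD _ _)) //.
rewrite mulr2n mulrDr mulr1 mulrDl lerD //.
  by rewrite (le_trans (key _ _ Kk)) // ler_wpM2l // ltW // hN //; exact: leq_maxl.
rewrite (le_trans (cauchy_schwarz _ _)) // mulrC ler_wpM2l // distrC ltW // hM //.
exact: leq_maxr.
Unshelve. all: by end_near. Qed.

End Projection.

(** * Defect spaces *)

Section Defect.
Context {R : realType} {H : completeNormedModType R[i]}.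
Variables (ip : {dot H for Num.conj}) (T : operator H).

Definition shifted_range (l : R[i]) : set H :=
  [set T x - l *: x | x in dom T].

Lemma dom_sub x y : dom T x -> dom T y -> dom T (x - y).
Proof.
by move=> Dx Dy; rewrite addrC -scaleN1r; apply: (dom_subspace T).2.
Qed.

Lemma app_sub x y : dom T x -> dom T y -> T (x - y) = T x - T y.
Proof.
move=> Dx Dy; rewrite addrC -scaleN1r (@app_linear _ _ T) //.
by rewrite scaleN1r addrC.
Qed.

Lemma shifted_range_subspace l : Defs.subspace (shifted_range l).
Proof.
have [D0 DP] := dom_subspace T; split.
  by exists 0 => //; rewrite -{1}[0](subrr 0) app_sub // subrr scaler0 subr0.
move=> a _ _ [x Dx <-] [y Dy <-]; exists (a *: x + y); first exact: DP.
rewrite app_linear // scalerBr scalerDr !scalerA [l * a]mulrC opprD addrACA.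
by [].
Qed.

(** If (T - l) (x n) converges, then the lower bound of T - l makes x n a Cauchy
sequence, and T (x n) converges as well; the graph is closed. *)
Lemma shifted_range_closed l : closed_op T -> regular_op T ->
  closed (shifted_range l).
Proof.
move=> Tc /(_ l)[c c0 hc] p clp.
have /choice[x hx] : forall n, exists x, dom T x /\
    `|p - (T x - l *: x)| < n.+1%:R^-1.
  move=> n; have n0 : 0 < (n.+1%:R^-1 : R[i]) by rewrite invr_gt0 ltr0n.
  have [_ [[x Dx <-]]] := clp _ (nbhsx_ballx p _ n0).
  by rewrite -ball_normE /= => hx; exists x.
have cx : cvg (x @ \oo).
  apply: (@cvg_of_harmonic _ _ _ c^-1); first by rewrite invr_gt0.
  move=> n m; have [Dn hn] := hx n; have [Dm hm] := hx m.
  rewrite mulrC ler_pdivlMr // mulrC (le_trans (hc _ (dom_sub _ _ Dn Dm))) //.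
  rewrite app_sub // scalerBr.
  have -> : T (x n) - T (x m) - (l *: x n - l *: x m) =
    (p - (T (x m) - l *: x m)) - (p - (T (x n) - l *: x n)).
    by rewrite (opprB p) [RHS]addrC addrA subrK !opprD addrACA.
  by rewrite (le_trans (ler_normB _ _)) // addrC lerD // ltW.
have Tx : (T \o x) @ \oo --> p + l *: lim (x @ \oo).
  have -> : T \o x = (fun n => T (x n) - l *: x n) \+ (fun n => l *: x n).
    by apply/funext => n /=; rewrite subrK.
  apply: cvgD; last by apply: cvgZr.
  apply/cvgrPdist_lt => e e0; near=> n.
  apply: lt_trans (hx n).2 _; near: n; exact: harmonic_complex_lt.
have [] : graph T (lim (x @ \oo), p + l *: lim (x @ \oo)).
  have xT : (fun n => (x n, T (x n))) @ \oo -->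
    (lim (x @ \oo), p + l *: lim (x @ \oo)).
    exact: (cvg_pair cx Tx).
  apply: (closed_cvg _ Tc _ _ xT).
  by near=> n; split => //; case: (hx n).
by move=> /= Dl El; exists (lim (x @ \oo)) => //; rewrite -El addrK.
Unshelve. all: by end_near. Qed.

Hypothesis ipN : hilbert_norm ip.

(** A vector orthogonal to the range of T - l^* is the first component of a
defect vector.  If there were none, then for x in the adjoint with [Gp x = 1]
and [Gm x = 0] one could write x = (y, T y) + (u, l^* u), and computing
[sform x x] in the triplet and from this decomposition would give
i = (l^* - l) |u|^2, in contradiction with Im l > 0. *)
Lemma defect_nontrivial Gp Gm l : symmetric_op ip T -> closed_op T ->
  regular_op T -> boundary_triplet ip T Gp Gm -> 0 < complex.Im l ->
  exists2 a, defect ip T l a & a.1 != 0.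
Proof.
move=> Ts Tc Tr tr l0.
have [x xT [Gp1 Gm0]] := triplet_surjective tr 1 0.
pose v := x.2 - Num.conj l *: x.1.
have [[y Dy Ey]|nv] := pselect (shifted_range (Num.conj l) v); last first.
  have [r Rr hr] := exists_orthogonal ip ipN _ v
    (shifted_range_subspace (Num.conj l)) (shifted_range_closed _ Tc Tr).
  exists (v - r, l *: (v - r)) => /=; last first.
    by rewrite subr_eq0; apply/eqP => vr; apply: nv; rewrite vr.
  split => // -[y z] [/= Dy ->]; rewrite /sform /=.
  have := hr _ (imageP _ Dy); rewrite ipBr ipZl ipZr conjCK => /eqP.
  by rewrite subr_eq0 => /eqP ->; rewrite subrr.
have [u uE] : exists u, u = x.1 - y by exists (x.1 - y).
have x1 : x.1 = y + u by rewrite uE addrC subrK.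
have x2 : x.2 = T y + Num.conj l *: u.
  by rewrite uE scalerBr addrCA Ey /v addrC subrK.
have xg : Num.conj l * ip u y = ip u (T y).
  have : sform ip x (y, T y) = 0 by apply: xT; split.
  rewrite /sform /= x1 x2 !ipDl ipZl (Ts _ _ Dy Dy) opprD addrACA subrr add0r.
  by move/eqP; rewrite subr_eq0 => /eqP.
have gx : l * ip y u = ip (T y) u.
  by rewrite ipC [RHS]ipC -xg rmorphM; congr (_ * _); rewrite -[LHS]conjCK.
(* The terms that involve y cancel, by symmetry of T and by xg and gx. *)
have xx : sform ip x x = (Num.conj l - l) * ip u u.
  rewrite /sform x1 x2 !ipDl !ipDr !ipZl !ipZr conjCK -gx -xg (Ts _ _ Dy Dy).
  ring.
move: xx; rewrite (triplet_green tr) // Gp1 Gm0.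
have [n n0 ->] : exists2 n : R, 0 <= n & ip u u = n%:C.
  have := ip_ge0 _ ipN u; rewrite -[ip u u]RRe_real ?ger0_real ?ip_ge0 // ler0c.
  by exists (complex.Re (ip u u)).
rewrite !conjE -complexiE; case: l l0 {v y Dy Ey uE x1 x2 xg gx} => a b /= b0.
simpc => -[E]; have := mulr_ge0 (ltW b0) n0.
move: E; rewrite mulrBl mulNr => E p0.
by have := @ltr01 R; rewrite E -opprD oppr_gt0 ltNge addr_ge0.
Qed.

(** By the Weyl function Gp a = 0 forces Gm a = 0, so that a would be in
the graph of T and a.1 would be an eigenvector; regularity excludes it. *)
Lemma defect_Gp_neq0 Gp Gm B l a : regular_op T ->
  boundary_triplet ip T Gp Gm -> weyl_function ip T Gp Gm B ->
  0 < complex.Im l -> defect ip T l a -> a.1 != 0 -> Gp a != 0.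
Proof.
move=> Tr tr wB l0 la a0; apply/eqP => Gp0; have [aT al] := la.
have Gm0 : Gm a = 0 by rewrite (wB _ l0 _ la) Gp0 mulr0.
have [Da] := triplet_injective tr aT Gp0 Gm0.
rewrite al => Ta; have [c c0 /(_ _ Da)] := Tr l.
rewrite -Ta subrr normr0 pmulr_rle0 // normr_le0.
exact/negP.
Qed.
End Defect.

(** * Decay of inner functions with positive mean type *)

Section InnerBound.
Context {R : realType}.

Lemma cexp_norm (z : R[i]) : `|cexp z| = (expR (complex.Re z))%:C.
Proof.
rewrite /cexp normrM [X in _ * X]normc_def /= cos2Dsin2 sqrtr1 mulr1.
by rewrite ger0_norm // ler0c expR_ge0.
Qed.

(** The conjugate of a zero w lies in the other half-plane, hence it is farther
from l than w is. *)
Lemma blaschke_factor_le1 (zk : option R[i]) l :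
  (forall w, zk = Some w -> 0 < complex.Im w) -> 0 < complex.Im l ->
  `|blaschke_factor zk l| <= 1.
Proof.
case: zk => [w|] /=; last by rewrite normr1.
move=> /(_ _ erefl) w0 l0.
rewrite !normrM !normfV norm_conjC mulfV ?mul1r; last first.
  by rewrite normr_eq0; apply: contraTneq w0 => ->; rewrite /= ltxx.
have lw : l - Num.conj w != 0.
  apply/eqP => /(congr1 (@complex.Im R)); rewrite conjE.
  by case: l l0 w w0 => a b /= b0 [c d] /= d0; lra.
rewrite ler_pdivrMr ?normr_gt0 // mul1r conjE.
rewrite !normc_def lecR ler_wsqrtr //.
by case: l l0 w w0 {lw} => a b /= b0 [c d] /= d0; nra.
Qed.

Lemma inner_factorization_bound (B : R[i] -> R[i]) b l :
  inner_factorization B b -> 0 < complex.Im l ->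
  `|B l| <= (expR (- (b * complex.Im l)))%:C.
Proof.
move=> [g [z [g1 b0 z0 _ Bl]]] l0; apply/ler_addgt0Pr => e e0.
have /cvgrPdist_le/(_ e e0)[N _ /(_ _ (leqnn N))] := Bl l l0.
set p := (X in B l - X) => hp.
have pB : `|p| <= (expR (- (b * complex.Im l)))%:C.
  rewrite /p normrM [`|g * _|]normrM g1 mul1r cexp_norm.
  have -> : complex.Re ('i * b%:C * l) = - (b * complex.Im l).
    by case: l {l0 p hp} => x y; rewrite -complexiE; simpc => /=.
  rewrite ler_piMr ?ler0c ?expR_ge0 // normr_prod.
  by apply: prodr_ile1 => k _; rewrite normr_ge0 blaschke_factor_le1 // => w /z0.
by rewrite -(subrK p (B l)) addrC (le_trans (ler_normD _ _)) // lerD.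
Qed.
End InnerBound.

(** * Uniqueness of the boundary condition *)

Section Uniqueness.
Context {R : realType} {H : completeNormedModType R[i]}.
Variables (ip : {dot H for Num.conj}) (T : operator H).
Hypothesis ipN : hilbert_norm ip.

Lemma adj_subspace : Defs.subspace (adj ip T).
Proof.
split=> [y _|a x y hx hy z Tz]; rewrite /sform /= ?ip0l ?subr0 //.
rewrite !ipDl !ipZl opprD addrACA -mulrBr.
have := hx _ Tz; have := hy _ Tz; rewrite /sform => -> ->.
by rewrite mulr0 addr0.
Qed.

(** Gp and Gm are coordinates on the quotient of the adjoint by the graph, in
the basis of the classes of e and f. *)
Lemma triplet_coordinates Gp Gm : boundary_triplet ip T Gp Gm ->
  exists e f, [/\ adj ip T e, Gp e = 1, Gm e = 0 &
   forall G : H * H -> R[i], linear_on (adj ip T) (G : H * H -> R[i]^o) ->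
     (forall x, graph T x -> G x = 0) ->
   forall x, adj ip T x -> G x = Gp x * G e + Gm x * G f].
Proof.
move=> tr; have [_ AP] := adj_subspace.
have [e Te [e1 e0]] := triplet_surjective tr 1 0.
have [f Tf [f0 f1]] := triplet_surjective tr 0 1.
exists e, f; split=> // G Gl G0 x Tx.
pose w := - Gp x *: e + (- Gm x *: f + x).
have Tw : adj ip T w by do 2 apply: (AP) => //.
have wE G' : linear_on (adj ip T) (G' : H * H -> R[i]^o) ->
    G' w = - Gp x * G' e + (- Gm x * G' f + G' x).
  by move=> L; rewrite /w L // ?L //; apply: AP.
have Pw : Gp w = 0.
  rewrite wE; last exact: triplet_linear_plus tr.
  by rewrite e1 f0 mulr1 mulr0 add0r addNr.
have Mw : Gm w = 0.
  rewrite wE; last exact: triplet_linear_minus tr.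
  by rewrite e0 f1 mulr1 mulr0 add0r addNr.
have := G0 _ (triplet_injective tr Tw Pw Mw).
rewrite wE // addrA !mulNr -opprD addrC => /eqP.
by rewrite subr_eq0 => /eqP.
Qed.

Lemma expRN_le (t : R) : 0 < t -> expR (- t) <= t^-1.
Proof.
move=> t0; rewrite expRN lef_pV2 ?posrE ?expR_gt0 //.
by apply: le_trans (expR_ge1Dx t); rewrite lerDr.
Qed.

Lemma cancel_scale (F : fieldType) (g x y b1 b2 p q : F) : g != 0 ->
  g * x + b1 * g * y = b2 * (g * p + b1 * g * q) ->
  x = b2 * (p + b1 * q) - b1 * y.
Proof.
move=> g0 E; apply: (mulfI g0); rewrite -[g * x](addrK (b1 * g * y)) E; ring.
Qed.

(** In the coordinates (Gp1, Gm1) the function Gm2 is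
x |-> Gp1 x * Gm2 e + Gm1 x * Gm2 f, so the inclusion of the kernels means that
the coefficient Gm2 e vanishes.  Evaluated at a defect vector at l = iy, the two Weyl
functions express Gm2 e through B1 l and B2 l, which both tend to 0. *)
Lemma nonvanishing_mean_type_sub m1 m2 b1 b2 :
  symmetric_op ip T -> closed_op T -> regular_op T ->
  mean_type ip T m1 b1 -> b1 != 0 -> mean_type ip T m2 b2 -> b2 != 0 ->
  m1 `<=` m2.
Proof.
move=> Ts Tc Tr [Gp1 [Gm1 [B1 [tr1 -> wB1 fB1]]]] b1n.
move=> [Gp2 [Gm2 [B2 [tr2 -> wB2 fB2]]]] b2n.
have b1p : 0 < b1 by case: fB1 => g [z [_]]; rewrite lt_neqAle eq_sym b1n.
have b2p : 0 < b2 by case: fB2 => g [z [_]]; rewrite lt_neqAle eq_sym b2n.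
have [e [f [Te e1 e0 coord]]] := triplet_coordinates _ _ tr1.
have cp := coord _ (triplet_linear_plus tr2)
  (fun x Tx => (triplet_vanish tr2 Tx).1).
have cm := coord _ (triplet_linear_minus tr2)
  (fun x Tx => (triplet_vanish tr2 Tx).2).
suff Ge : Gm2 e = 0.
  move=> x [Tx]; rewrite !mul0r => Gx; split=> //.
  by rewrite cm // Ge Gx mul0r !mulr0 addr0 mul0r.
apply/normr0_eq0/(@eps_le0 _ (`|Gp2 e| + `|Gp2 f| + `|Gm2 f|)) => // eps.
move=> eps0; have epsE : eps = (complex.Re eps)%:C by rewrite RRe_real ?gtr0_real.
have {eps0}: 0 < complex.Re eps by rewrite -ltcR -epsE.
rewrite {}epsE; move: (complex.Re eps) => {eps} r r0.
(* This y makes both b1 * y and b2 * y at least 1 / r, and exp(-t) <= 1 / t. *)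
pose y := (r * b1)^-1 + (r * b2)^-1; pose l := Complex 0 y.
have i1 : 0 < (r * b1)^-1 by rewrite invr_gt0 mulr_gt0.
have i2 : 0 < (r * b2)^-1 by rewrite invr_gt0 mulr_gt0.
have l0 : 0 < complex.Im l by rewrite addr_gt0.
have small B b : 0 < b -> (r * b)^-1 <= y ->
    inner_factorization B b -> `|B l| <= r%:C.
  move=> b0 hy fB; rewrite (le_trans (inner_factorization_bound _ _ _ fB l0)) //.
  rewrite lecR.
  have rb : r^-1 <= b * y by rewrite mulrC -ler_pdivrMr // -invfM.
  have by0 : 0 < b * y by rewrite mulr_gt0.
  by rewrite (le_trans (expRN_le _ by0)) // -[leRHS]invrK lef_pV2 // posrE invr_gt0.
have B1r : `|B1 l| <= r%:C by apply: (small _ _ b1p _ fB1); rewrite lerDl ltW.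
have B2r : `|B2 l| <= r%:C by apply: (small _ _ b2p _ fB2); rewrite lerDr ltW.
have B1_1 : `|B1 l| <= 1.
  rewrite (le_trans (inner_factorization_bound _ _ _ fB1 l0)) // lecR.
  by rewrite -expR0 ler_expR oppr_le0 mulr_ge0 ?ltW.
have [a la a0] := defect_nontrivial _ _ ipN _ _ _ Ts Tc Tr tr1 l0.
have Ga := defect_Gp_neq0 _ _ _ _ _ _ _ Tr tr1 wB1 l0 la a0.
have E : Gm2 e = B2 l * (Gp2 e + B1 l * Gp2 f) - B1 l * Gm2 f.
  have := wB2 l l0 a la.
  have aT := la.1.
  rewrite (cm a aT).
  rewrite (cp a aT).
  rewrite (wB1 l l0 a la).
  exact: cancel_scale Ga.
rewrite E (le_trans (ler_normB _ _)) // mulrDl lerD //; last first.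
  by rewrite normrM mulrC ler_wpM2l.
rewrite normrM mulrC ler_pM // (le_trans (ler_normD _ _)) // lerD //.
by rewrite normrM ler_piMl.
Qed.
End Uniqueness.

(** * The Fubini-Study geometry of the projective line *)

Section ProjectiveLine.
Context {R : realType} {H : completeNormedModType R[i]}.
Variables (ip : {dot H for Num.conj}) (T : operator H).
Hypothesis ipN : hilbert_norm ip.

Lemma ip2Zl a x y : ip2 ip (a *: x) y = a * ip2 ip x y.
Proof. by rewrite /ip2 /= !ipZl mulrDr. Qed.

Lemma ip2C x y : ip2 ip x y = Num.conj (ip2 ip y x).
Proof. by rewrite /ip2 ipC [ip _ y.2]ipC rmorphD. Qed.

Lemma ip2Zr a x y : ip2 ip x (a *: y) = Num.conj a * ip2 ip x y.
Proof. by rewrite /ip2 /= !ipZr mulrDr. Qed.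

Lemma ip2Dl x y z : ip2 ip (x + y) z = ip2 ip x z + ip2 ip y z.
Proof. by rewrite /ip2 /= !ipDl addrACA. Qed.

Lemma ip2Bl x y z : ip2 ip (x - y) z = ip2 ip x z - ip2 ip y z.
Proof. by rewrite ip2Dl -scaleN1r ip2Zl mulN1r. Qed.

Lemma ip2Br x y z : ip2 ip x (y - z) = ip2 ip x y - ip2 ip x z.
Proof. by rewrite /ip2 /= !ipBr opprD addrACA. Qed.

Lemma ip2_ge0 x : 0 <= ip2 ip x x.
Proof. by rewrite addr_ge0 ?ip_ge0. Qed.

Lemma ip2_eq0 x : ip2 ip x x = 0 -> x = 0.
Proof.
move/eqP; rewrite paddr_eq0 ?ip_ge0 // !ipN !expf_eq0 /= !normr_eq0.
by case: x => x y /= /andP[/eqP -> /eqP ->].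
Qed.

Lemma ip2_unit_lt1 x y : ip2 ip x x = 1 -> ip2 ip y y = 1 ->
  (forall c, x <> c *: y) -> `|ip2 ip x y| < 1.
Proof.
move=> x1 y1 xy; pose c := ip2 ip x y.
have E : ip2 ip (x - c *: y) (x - c *: y) = 1 - `|c| ^+ 2.
  rewrite ip2Bl !ip2Br !ip2Zr !ip2Zl x1 y1 (ip2C y x) normCK /c; ring.
rewrite -(@expr_lt1 _ 2) // lt_neqAle -subr_ge0 -E ip2_ge0 andbT.
apply/eqP => c1; apply: (xy c); apply/eqP; rewrite -subr_eq0; apply/eqP.
by apply: ip2_eq0; rewrite E c1 subrr.
Qed.

Lemma graph_subspace : Defs.subspace (graph T).
Proof.
have [D0 DP] := dom_subspace T; split.
  split=> //=; rewrite -{2}[0](subrr 0) app_sub // subrr //.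
by move=> a x y [Dx xE] [Dy yE]; split; [exact: DP|rewrite /= xE yE app_linear].
Qed.

Lemma line_eq u v : line T v u -> ~ graph T u -> line T v = line T u.
Proof.
have [G0 GP] := graph_subspace.
move=> [c [a [Ga uE]]] Gu.
have c0 : c != 0 by apply: contra_notN Gu => /eqP c0; rewrite uE c0 scale0r add0r.
apply/seteqP; split=> _ [k [b [Gb ->]]].
  exists (k / c), (- (k / c) *: a + b); split; first exact: GP.
  by rewrite uE scalerDr scalerA divfK // scaleNr addrA addrK.
exists (k * c), (k *: a + b); split; first exact: GP.
by rewrite uE scalerDr scalerA addrA.
Qed.

(** Two unit vectors whose inner product has modulus 1 are proportional, so they
span the same line.  A line without unit vector is assigned the vector 0 by
[unit_vector], and its distance to any point is pi / 2. *)
Lemma fs_dist_gt0 m m' : boundary_conditions ip T m ->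
  boundary_conditions ip T m' -> m <> m' -> 0 < fs_dist ip T m m'.
Proof.
move=> [v _ <-] [v' _ <-] vv'.
pose U m := [set u | [/\ m u, quotient_space ip T u & ip2 ip u u = 1]].
have uP w : unit_vector ip T (line T w) = 0 \/
    U (line T w) (unit_vector ip T (line T w)).
  have [ex|nex] := pselect (exists u, U (line T w) u).
    by right; exact: (xgetPex 0 ex).
  by left; apply: xgetPN => u Uu; apply: nex; exists u.
have ng u : quotient_space ip T u -> ip2 ip u u = 1 -> ~ graph T u.
  by move=> [_ qu] u1 Gu; move: u1; rewrite qu // => /eqP; rewrite eq_sym oner_eq0.
apply: acos_gt0.
suff : `|ip2 ip (unit_vector ip T (line T v)) (unit_vector ip T (line T v'))| < 1.
  set n := `|_| => n1.
  have nE : n = (complex.Re n)%:C by rewrite RRe_real ?ger0_real ?normr_ge0.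
  have : 0 <= n by rewrite normr_ge0.
  move: n1; rewrite nE ltcR ler0c /= => -> n0.
  by rewrite (le_trans _ n0) // lerN10.
case: (uP v) => [->|[vu qu u1]].
  by rewrite -[0](scale0r (0 : H * H)) ip2Zl mul0r normr0.
case: (uP v') => [->|[vu' qu' u1']].
  by rewrite -[0](scale0r (0 : H * H)) ip2Zr rmorph0 mul0r normr0.
apply: ip2_unit_lt1 => // c uE; apply: vv'.
rewrite (line_eq _ _ vu (ng _ qu u1)) (line_eq _ _ vu' (ng _ qu' u1')).
apply/esym/line_eq; last exact: ng.
by exists c, 0; split; [exact: graph_subspace.1 | rewrite addr0].
Qed.

(** The complement of the point m is open: around m' the ball of radius
[fs_dist m' m] avoids m. *)
Lemma borel_measurable_set1 m : boundary_conditions ip T m ->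
  borel_measurable ip T [set m].
Proof.
move=> bm; have -> : [set m] =
    boundary_conditions ip T `\` (boundary_conditions ip T `\ m).
  by rewrite setDD; apply/seteqP; split=> [_ ->//|x []].
apply: sigma_algebraCD; apply: sub_sigma_algebra; split=> [x []//|m' [bm' mm']].
exists (fs_dist ip T m' m); first exact: fs_dist_gt0.
by move=> m'' bm'' h; split=> // E; move: h; rewrite E ltxx.
Qed.

(** The inner products with e1 and e2 recover the homogeneous coordinates,
because the graph is orthogonal to both vectors. *)
Lemma fs_chart_inj e1 e2 : orthonormal_basis ip T e1 e2 ->
  injective (fs_chart T e1 e2).
Proof.
move=> [[q1 q2] n1 n2 n12 _] z z' zz'.
have : line T (e1 + Complex z'.1 z'.2 *: e2) (e1 + Complex z'.1 z'.2 *: e2).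
  by exists 1, 0; split; [exact: graph_subspace.1|rewrite scale1r addr0].
move: zz'; rewrite /fs_chart => <- [c [a [Ga E]]].
have n21 : ip2 ip e2 e1 = 0 by rewrite ip2C n12 rmorph0.
have ae e : quotient_space ip T e -> ip2 ip a e = 0.
  by move=> [_ qe]; rewrite ip2C qe // rmorph0.
have c1 : c = 1.
  move: (congr1 (fun x => ip2 ip x e1) E).
  rewrite !ip2Dl !ip2Zl !ip2Dl !ip2Zl n1 n21 (ae _ q1) !mulr0 !addr0 mulr1.
  by move=> <-.
move: (congr1 (fun x => ip2 ip x e2) E).
rewrite !ip2Dl !ip2Zl !ip2Dl !ip2Zl n2 n12 (ae _ q2) c1 mul1r !mulr1 !add0r addr0.
by case: z z' {E} => [a1 b1] [a2 b2] [-> ->].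
Qed.

Lemma fs_volume_set1 e1 e2 m : orthonormal_basis ip T e1 e2 ->
  fs_volume T e1 e2 [set m] = 0%E.
Proof.
move=> /fs_chart_inj inj; rewrite /fs_volume.
have [[z zm]|nz] := pselect (exists z, fs_chart T e1 e2 z = m); last first.
  have -> : fs_chart T e1 e2 @^-1` [set m] = set0.
    by apply/seteqP; split=> // z /= zm; apply: nz; exists z.
  by rewrite integral_set0.
have -> : fs_chart T e1 e2 @^-1` [set m] = [set z.1] `*` [set z.2].
  apply/seteqP; split=> [w /= wm|[a b] [/= -> ->]]; last first.
    by rewrite -surjective_pairing.
  by have -> : w = z by apply: inj; rewrite wm zm.
have mz : measurable ([set z.1] `*` [set z.2] : set (R * R)).
  exact: measurableX.
pose k : \bar R := (pi * (1 + z.1 ^+ 2 + z.2 ^+ 2) ^+ 2)^-1%:E.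
rewrite (eq_integral (fun=> k)); last first.
  by move=> [a b]; rewrite inE => -[/= -> ->].
have z0 : (lebesgue_measure \x lebesgue_measure)%E ([set z.1] `*` [set z.2])
    = 0%E :> \bar R.
  rewrite product_measure1E //.
  transitivity (lebesgue_measure [set z.1] * lebesgue_measure [set z.2])%E => //.
  by rewrite !lebesgue_measure_set1 mule0.
rewrite integral_cst //.
by rewrite [X in (_ * X)%E]z0 mule0.
Qed.
End ProjectiveLine.

(** * Boundary conditions with non-vanishing mean type *)

Theorem theorem6p9 (R : realType) (H : completeNormedModType R[i])
    (ip : {dot H for Num.conj}) (T : operator H) :
  hilbert_norm ip -> separable H -> infinite_dimensional H ->
  entire_operator11 ip T ->
  borel_measurable ip T (nonvanishing_mean_type ip T) /\
  (forall e1 e2 : H * H, orthonormal_basis ip T e1 e2 ->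
     fs_volume T e1 e2 (nonvanishing_mean_type ip T) = 0%E).
Proof.
move=> ipN _ _ [Ts Tc _ _ Tr].
have at_most_one m1 m2 : nonvanishing_mean_type ip T m1 ->
    nonvanishing_mean_type ip T m2 -> m1 = m2.
  move=> [_ _ [b1 mt1 b10]] [_ _ [b2 mt2 b20]]; apply/seteqP; split.
    exact: nonvanishing_mean_type_sub Ts Tc Tr mt1 b10 mt2 b20.
  exact: nonvanishing_mean_type_sub Ts Tc Tr mt2 b20 mt1 b10.
have [[m Cm]|nC] := pselect (exists m, nonvanishing_mean_type ip T m).
  have -> : nonvanishing_mean_type ip T = [set m].
    by apply/seteqP; split=> [m' Cm'|_ ->//]; exact: at_most_one.
  split; first by apply: borel_measurable_set1 => //; case: Cm.
  by move=> e1 e2 /fs_volume_set1; apply.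
have -> : nonvanishing_mean_type ip T = set0.
  by apply/seteqP; split=> // m Cm; apply: nC; exists m.
split; first exact: sigma_algebra0.
by move=> e1 e2 _; rewrite /fs_volume preimage_set0 integral_set0.
Qed.
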